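(* Let $x^\ast$ be a stable differential Nash equilibrium of an $n$-player continuous game $(f_1,\dots,f_n)$ on $X=\mathbb{R}^{d_1}\times\cdots\times\mathbb{R}^{d_n}$, with each $f_i\in C^q(X,\mathbb{R})$ for some $q\ge2$ and $\omega=(D_1f_1,\dots,D_nf_n)$ Lipschitz. Let $\Gamma=\mathrm{blockdiag}(\gamma_1I_{d_1},\dots,\gamma_nI_{d_n})$ with learning rates $\gamma_i>0$. Suppose that $\|I-\Gamma J(x)\|<1$ for all $x\in B_{r_0}(x^\ast)\subset\mathcal{V}(x^\ast)$, so that there exist $r',r''$ such that $\|I-\Gamma J(x)\|\le r'<r''<1$ for all $x\in B_{r_0}(x^\ast)$. Let $\tilde g(x)=x-\Gamma\omega(x)$ and let $R$ be the remainder in $$\tilde g(x)=\tilde g(x^\ast)+(I-\Gamma J(x))(x-x^\ast)+R(x-x^\ast),\qquad \lim_{x\to x^\ast}\frac{\|R(x-x^\ast)\|}{\|x-x^\ast\|}=0.$$ Since $1-r''>0$, let $0<r<\infty$ be the largest $r$ such that $\|R(x-x^\ast)\|\le(1-r'')\|x-x^\ast\|$ for all $x\in B_r(x^\ast)$. Let $r^\ast=\min\{r,r_0\}$ and let $x_0\in B_{r^\ast}(x^\ast)$ be arbitrary. Then, given $\varepsilon>0$, the gradient-based learning rule $x_{k+1}=x_k-\Gamma\omega(x_k)$ obtains an $\varepsilon$-differential Nash equilibrium in finite time, i.e. $x_k\in B_\varepsilon(x^\ast)$ for all $$k\ge T=\left\lceil\frac1\delta\log\left(\frac{r^\ast}{\varepsilon}\right)\right\rceil,\qquad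 \delta=r''-r'.$$
   Context: Player $i$ chooses $x_i\in\mathbb{R}^{d_i}$ and has cost $f_i:X\to\mathbb{R}$; $D_if_i$ is the derivative of $f_i$ with respect to $x_i$ and $D_i^2f_i$ the second derivative with respect to $x_i$. $J(x)$ denotes the Jacobian of $\omega$ at $x$. A point $x^\ast$ is a differential Nash equilibrium if $\omega(x^\ast)=0$ and $D_i^2f_i(x^\ast)$ is positive definite for each $i$; it is stable if every eigenvalue of $J(x^\ast)$ has strictly positive real part. $\mathcal{V}(x^\ast)$ is the region of attraction of $x^\ast$ for $\dot x=-\omega(x)$, and $B_{r_0}(x^\ast)$, $0<r_0<\infty$, is the largest ball around $x^\ast$ contained in $\mathcal{V}(x^\ast)$. $\|\cdot\|$ is a norm on $\mathbb{R}^d$, $d=\sum_id_i$, and also its induced operator norm; $B_\rho(x^\ast)$ is the ball of radius $\rho$ around $x^\ast$. *)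

(* Defs.v *)
From mathcomp Require Export all_boot all_order all_algebra.
From mathcomp Require Export all_classical all_reals all_analysis.
From mathcomp Require Export complex.

Set Implicit Arguments.
Unset Strict Implicit.
Unset Printing Implicit Defensive.

Export Order.TTheory GRing.Theory Num.Theory.
Export numFieldNormedType.Exports.

Local Open Scope classical_set_scope.
Local Open Scope ring_scope.

Definition partial (R : realType) (m : nat) (j : 'I_m) (f : 'cV[R]_m -> R)
    (x : 'cV[R]_m) : R :=
  'D_(delta_mx j 0 : 'cV[R]_m) f x.

Fixpoint class_C (R : realType) (m q : nat) (f : 'cV[R]_m -> R) : Prop :=
  if q is q'.+1 then
    (forall x, differentiable f x) /\ forall j, class_C q' (partial j f)
  else continuous f.

(* Usual convention, (J F x) a b = d F_a / d x_b, acting on column vectors; the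
   library's jacobian acts on row vectors and is the transpose of this one. *)
Definition jacobian_mx (R : realType) (m p : nat) (F : 'cV[R]_m -> 'cV[R]_p)
    (x : 'cV[R]_m) : 'M[R]_(p, m) :=
  \matrix_(a, b) partial b (fun y => F y a 0) x.

(* The joint strategy space R^(d 0) x ... x R^(d (n-1)) is identified with the
   column vectors of size \sum_i d i; tagnat.Rank i j is the position in the
   joint vector of the j-th coordinate of player i, so that
   x = \mxcol_i submxcol x i. *)
Notation joint R d := 'cV[R]_(\sum_i d i).

Definition player_grad (R : realType) (n : nat) (d : 'I_n -> nat) (i : 'I_n)
    (f : joint R d -> R) (x : joint R d) : 'cV[R]_(d i) :=
  \col_(j < d i) partial (tagnat.Rank i j) f x.

Definition player_hess (R : realType) (n : nat) (d : 'I_n -> nat) (i : 'I_n)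
    (f : joint R d -> R) (x : joint R d) : 'M[R]_(d i) :=
  \matrix_(j, k) partial (tagnat.Rank i j) (partial (tagnat.Rank i k) f) x.

Definition game_form (R : realType) (n : nat) (d : 'I_n -> nat)
    (f : 'I_n -> joint R d -> R) (x : joint R d) : joint R d :=
  \mxcol_i player_grad i (f i) x.

Definition posdef (R : realType) (m : nat) (A : 'M[R]_m) : Prop :=
  forall v : 'cV[R]_m, v != 0 -> 0 < (v^T *m A *m v) 0 0.

Definition differential_Nash (R : realType) (n : nat) (d : 'I_n -> nat)
    (f : 'I_n -> joint R d -> R) (x : joint R d) : Prop :=
  game_form f x = 0 /\ forall i, posdef (player_hess i (f i) x).

(* The eigenvalues of the real matrix are taken in R[i]. *)
Definition stable (R : realType) (n : nat) (d : 'I_n -> nat)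
    (f : 'I_n -> joint R d -> R) (x : joint R d) : Prop :=
  forall z : R[i],
    eigenvalue (map_mx (real_complex R) (jacobian_mx (game_form f) x)) z ->
    0 < complex.Re z.

Definition vector_norm (R : realType) (m : nat) (N : 'cV[R]_m -> R) : Prop :=
  [/\ forall u v, N (u + v) <= N u + N v,
      forall (a : R) v, N (a *: v) = `|a| * N v &
      forall v, N v = 0 -> v = 0].

Definition opnorm (R : realType) (m : nat) (N : 'cV[R]_m -> R) (A : 'M[R]_m) : R :=
  sup [set N (A *m v) | v in [set v | N v <= 1]].

Definition nball (R : realType) (m : nat) (N : 'cV[R]_m -> R) (c : 'cV[R]_m)
    (rho : R) : set 'cV[R]_m :=
  [set x | N (x - c) < rho].

Definition is_lipschitz (R : realType) (m : nat) (N : 'cV[R]_m -> R)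
    (F : 'cV[R]_m -> 'cV[R]_m) : Prop :=
  exists L : R, forall x y, N (F x - F y) <= L * N (x - y).

(* Points from which a solution of x' = - F x defined for all t >= 0 converges
   to xs. The derivative at t = 0 is two-sided, which is no restriction: a
   forward solution can be continued affinely to t < 0. *)
Definition region_of_attraction (R : realType) (m : nat)
    (F : 'cV[R]_m -> 'cV[R]_m) (xs : 'cV[R]_m) : set 'cV[R]_m :=
  [set x0 | exists phi : R -> 'cV[R]_m,
     [/\ phi 0 = x0,
         forall t : R, 0 <= t -> is_derive t 1 phi (- F (phi t)) &
         phi t @[t --> +oo] --> xs]].

Definition is_largest (R : realType) (P : set R) (r : R) : Prop :=
  P r /\ forall s, P s -> s <= r.

Definition rate_mx (R : realType) (n : nat) (d : 'I_n -> nat)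
    (gamma : 'I_n -> R) : 'M[R]_(\sum_i d i) :=
  \mxdiag_(i < n) ((gamma i)%:M : 'M[R]_(d i)).

(* Main.v *)
Require Import Defs.
From mathcomp Require Import lra.

Set Implicit Arguments.
Unset Strict Implicit.
Unset Printing Implicit Defensive.

Local Open Scope classical_set_scope.
Local Open Scope ring_scope.

(** The rule x_(k+1) = g (x_k) is a contraction towards [xs] near [xs]. Since
    the game form vanishes at [xs], [g] fixes [xs], and the expansion of [g]
    reads g y - xs = (I - Gamma J(y)) (y - xs) + Rem (y - xs). On the ball of
    radius [rs] the first term has norm at most r' N (y - xs) and the second at
    most (1 - r'') N (y - xs), whence ([gradient_step_contracts])
      N (g y - xs) <= (1 - delta) N (y - xs),   delta = r'' - r'.
    The factor lies in ]0, 1[, because 0 <= r' < r'' < 1; so the orbit stays in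
    the ball and N (x_k - xs) < (1 - delta)^k rs <= exp (- delta k) rs, which is
    at most [eps] as soon as delta k >= ln (rs / eps).

    The only analytic point is that the operator norm controls the action of a
    matrix ([opnorm_apply]). It is a supremum, meaningful only when the unit
    ball of [N] has a bounded image; this is the equivalence of norms in finite
    dimension: every seminorm is dominated by the coordinatewise maximum norm
    ([seminorm_upper]), hence continuous, hence a norm is bounded below on the
    compact unit sphere ([norm_lower]). *)

(** * Norms on column vectors and their operator norms *)

(** Definiteness is left out because [v |-> N (A v^T)] lacks it when [A] is
    singular. The argument is a row, as in the Heine-Borel theorem
    [bounded_closed_compact]; norms of columns are carried over by
    transposition. *)
Definition seminorm (R : realType) (m : nat) (p : 'rV[R]_m -> R) : Prop :=
  (forall u v, p (u + v) <= p u + p v) /\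
  (forall (a : R) v, p (a *: v) = `|a| * p v).

Section Seminorm.
Context (R : realType) (m : nat) (p : 'rV[R]_m -> R).
Hypothesis pS : seminorm p.

Lemma seminorm0 : p 0 = 0.
Proof. by rewrite -(scale0r 0) pS.2 normr0 mul0r. Qed.

Lemma seminormN v : p (- v) = p v.
Proof. by rewrite -scaleN1r pS.2 normrN normr1 mul1r. Qed.

Lemma seminorm_ge0 v : 0 <= p v.
Proof.
have := pS.1 v (- v); rewrite subrr seminorm0 seminormN; lra.
Qed.

(** The constant is the sum of the values of [p] on the canonical basis. *)
Lemma seminorm_upper : exists2 C, 0 <= C & forall v, p v <= C * `|v|.
Proof.
exists (\sum_(i < m) p (delta_mx 0 i)).
  by apply: sumr_ge0 => i _; exact: seminorm_ge0.
move=> v; rewrite {1}(row_sum_delta v) mulr_suml.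
apply: (@le_trans _ _ (\sum_(i < m) p (v 0 i *: delta_mx 0 i))).
  elim/big_ind2: _ => //; first by rewrite seminorm0.
  by move=> a b c e ab ce; apply: le_trans (pS.1 _ _) _; exact: lerD.
apply: ler_sum => i _; rewrite pS.2 mulrC ler_wpM2l ?seminorm_ge0//.
rewrite [leRHS]/Num.Def.normr/= mx_normrE; apply/bigmax_geP; right => /=.
by exists (0, i).
Qed.

Lemma seminorm_continuous : continuous p.
Proof.
have [C C0 pC] := seminorm_upper => v.
apply/(@cvgrPdist_le _ _ _ (nbhs v)) => e e0.
(* C may vanish, so the radius is e / (C + 1) *)
have C1 : 0 < C + 1 by lra.
near=> w.
have vw : C * `|v - w| <= e.
  apply: (@le_trans _ _ ((C + 1) * `|v - w|)).
    by rewrite ler_wpM2r//; lra.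
  rewrite mulrC -ler_pdivlMr//.
  by near: w; apply: cvgr_dist_le => //; exact: divr_gt0.
apply: le_trans vw; apply: le_trans (pC _).
have := pS.1 (v - w) w; rewrite subrK => h1.
have := pS.1 (w - v) v; rewrite subrK -(opprB v w) seminormN => h2.
by rewrite ler_norml; apply/andP; split; lra.
Unshelve. all: by end_near. Qed.

(** The constant is the minimum of [p] on the compact unit sphere, attained at a
    nonzero vector. *)
Lemma norm_lower : (forall v, p v = 0 -> v = 0) ->
  exists2 c, 0 < c & forall v, c * `|v| <= p v.
Proof.
move=> p0.
pose S := [set v : 'rV[R]_m | `|v| = 1].
have normalize v : v != 0 -> S (`|v|^-1 *: v).
  by move=> v0; rewrite /S/= normrZ normfV normr_id mulVf// normr_eq0.
have [S0|/set0P S0] := eqVneq S set0.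
  (* empty sphere: the space is trivial *)
  exists 1 => // v; have [->|/normalize] := eqVneq v 0; last by rewrite S0.
  by rewrite normr0 mulr0 seminorm0.
have cS : compact S.
  apply: bounded_closed_compact.
    by exists 1; split => // M M1 v /= ->; exact: ltW.
  rewrite (_ : S = (fun v : 'rV[R]_m => `|v|) @^-1` [set 1])//.
  apply: preimage_closed => [v _|]; first exact: norm_continuous.
  exact: closed_eq.
have [c Sc minc] := compact_EVT_min S0 cS
  (continuous_subspaceT seminorm_continuous).
have c0 : 0 < p c.
  rewrite lt_neqAle seminorm_ge0 andbT eq_sym; apply/eqP => /p0 c0.
  by move: Sc; rewrite inE /S/= c0 normr0 => /eqP; rewrite eq_sym oner_eq0.
exists (p c) => // v; have [->|v0] := eqVneq v 0.
  by rewrite normr0 mulr0 seminorm0.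
have := minc _ (mem_set (normalize _ v0)).
by rewrite pS.2 normfV normr_id mulrC ler_pdivlMr// normr_gt0.
Qed.

End Seminorm.

Section OperatorNorm.
Context (R : realType) (m : nat) (N : 'cV[R]_m -> R).
Hypothesis NN : vector_norm N.

Let seminorm_trmx (A : 'M[R]_m) : seminorm (fun v : 'rV_m => N (A *m v^T)).
Proof.
have [ND NZ _] := NN; split=> [u v|a v].
- by rewrite linearD mulmxDr.
- by rewrite linearZ -scalemxAr.
Qed.

Let seminorm_tr : seminorm (fun v : 'rV_m => N v^T).
Proof.
have [ND NZ _] := NN; split=> [u v|a v]; first by rewrite linearD.
by rewrite linearZ/= NZ.
Qed.

Lemma vector_norm0 : N 0 = 0.
Proof. by have := seminorm0 seminorm_tr; rewrite trmx0. Qed.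

Lemma vector_norm_ge0 v : 0 <= N v.
Proof. by have := seminorm_ge0 seminorm_tr v^T; rewrite trmxK. Qed.

(** Without it [opnorm] would carry no information, as [sup] takes a default
    value on unbounded sets. By [norm_lower] the unit ball of [N] is bounded for
    the maximum norm, where [seminorm_upper] applies to [v |-> N (A v)]. *)
Lemma opnorm_has_sup (A : 'M[R]_m) :
  has_sup [set N (A *m v) | v in [set v | N v <= 1]].
Proof.
have [_ _ N0] := NN; split.
  by exists (N (A *m 0)), 0 => //=; rewrite vector_norm0.
have [c c0 cN] : exists2 c, 0 < c & forall v : 'rV_m, c * `|v| <= N v^T.
  apply: (norm_lower seminorm_tr) => v /N0 /(congr1 trmx).
  by rewrite trmxK trmx0.
have [C C0 NC] := seminorm_upper (seminorm_trmx A).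
exists (C / c) => _ [v /= v1 <-]; have := NC v^T; rewrite trmxK => h.
apply: le_trans h _; rewrite ler_wpM2l// -[c^-1]mul1r ler_pdivlMr// mulrC.
by apply: le_trans (cN _) _; rewrite trmxK.
Qed.

Lemma opnorm_ge0 (A : 'M[R]_m) : 0 <= opnorm N A.
Proof.
apply: ub_le_sup; first exact: (opnorm_has_sup A).2.
by exists 0; rewrite /= ?mulmx0 vector_norm0.
Qed.

Lemma opnorm_apply (A : 'M[R]_m) v : N (A *m v) <= opnorm N A * N v.
Proof.
have [_ NZ N0] := NN.
have [->|v0] := eqVneq v 0; first by rewrite mulmx0 vector_norm0 mulr0.
have Nv : 0 < N v.
  by rewrite lt_neqAle vector_norm_ge0 andbT eq_sym; apply: contra_neq v0 => /N0.
rewrite -ler_pdivrMr//; apply: ub_le_sup; first exact: (opnorm_has_sup A).2.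
have NV : `|(N v)^-1| = (N v)^-1 by rewrite ger0_norm// invr_ge0 ltW.
exists ((N v)^-1 *: v) => /=; first by rewrite NZ NV mulVf// gt_eqF.
by rewrite -scalemxAr NZ NV mulrC.
Qed.

End OperatorNorm.

(** * Contraction and the number of steps *)

Lemma gradient_step_contracts (R : realType) (m : nat) (N : 'cV[R]_m -> R)
    (A : 'M[R]_m) (u e : 'cV[R]_m) (r' r'' : R) :
  vector_norm N -> opnorm N A <= r' -> N e <= (1 - r'') * N u ->
  N (A *m u + e) <= (1 - (r'' - r')) * N u.
Proof.
move=> NN Ar eu; have [ND _ _] := NN.
apply: le_trans (ND _ _) _; apply: le_trans (lerD (opnorm_apply NN A u) eu) _.
by rewrite -mulrDl ler_wpM2r ?vector_norm_ge0//; lra.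
Qed.

(** This is 1 - a <= exp (- a), raised to the power [k] and evaluated where
    exp (- a k) has fallen to [e / s]. *)
Lemma geometric_le_of_ceil (R : realType) (a s e : R) (k : nat) :
  0 < a -> a < 1 -> 0 < s -> 0 < e ->
  Num.ceil (1 / a * ln (s / e)) <= k%:Z -> (1 - a) ^+ k * s <= e.
Proof.
move=> a0 a1 s0 e0 hk.
have h : ln (s / e) <= k%:R * a.
  have : 1 / a * ln (s / e) <= k%:R by move: hk; rewrite ceil_le_int.
  by rewrite div1r mulrC ler_pdivrMr.
have h1 : (1 - a) ^+ k <= expR (- (k%:R * a)).
  rewrite -mulrN mulrC expRM_natr lerXn2r ?nnegrE ?expR_ge0//; first lra.
  exact: expR_ge1Dx.
rewrite -ler_pdivlMr//; apply: le_trans h1 _.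
rewrite expRN -[e / s]invrK invf_div lef_pV2 ?posrE ?expR_gt0 ?divr_gt0//.
by rewrite -ler_ln ?posrE ?expR_gt0 ?divr_gt0// expRK.
Qed.


Theorem proposition4 (R : realType) (n : nat) (d : 'I_n -> nat)
  (f : 'I_n -> joint R d -> R) (q : nat) (xs : joint R d)
  (N : joint R d -> R) (gamma : 'I_n -> R)
  (r0 r' r'' r eps : R) (Rem : joint R d -> joint R d)
  (x : nat -> joint R d) :
  let omega := game_form f in
  let J := jacobian_mx omega in
  let Gamma := rate_mx d gamma in
  let g := fun y => y - Gamma *m omega y in
  let rs := Num.min r r0 in
  let delta := r'' - r' in
  vector_norm N ->
  (2 <= q)%N ->
  (forall i, class_C q (f i)) ->
  is_lipschitz N omega ->
  differential_Nash f xs ->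
  stable f xs ->
  (forall i, 0 < gamma i) ->
  0 < r0 ->
  is_largest
    [set rho | nball N xs rho `<=` region_of_attraction omega xs] r0 ->
  (forall y, nball N xs r0 y -> opnorm N (1%:M - Gamma *m J y) < 1) ->
  (forall y, nball N xs r0 y -> opnorm N (1%:M - Gamma *m J y) <= r') ->
  r' < r'' ->
  r'' < 1 ->
  (forall y,
    g y = g xs + (1%:M - Gamma *m J y) *m (y - xs) + Rem (y - xs)) ->
  N (Rem (y - xs)) / N (y - xs) @[y --> xs^'] --> (0 : R) ->
  0 < r ->
  is_largest
    [set rho | forall y, nball N xs rho y ->
       N (Rem (y - xs)) <= (1 - r'') * N (y - xs)] r ->
  nball N xs rs (x 0%N) ->
  (forall k, x k.+1 = x k - Gamma *m omega (x k)) ->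
  0 < eps ->
  forall k : nat, Num.ceil (1 / delta * ln (rs / eps)) <= k%:Z ->
    nball N xs eps (x k).
Proof.
move=> omega J Gamma g rs delta NN _ _ _ [omega0 _] _ _ r0_gt0 _ _ Jr' r'r'' r''1.
move=> gE _ r_gt0 [Remr _] x0 xS eps_gt0 k hk.
have r'_ge0 : 0 <= r'.
  have xs_in : nball N xs r0 xs by rewrite /nball/= subrr vector_norm0.
  exact: le_trans (opnorm_ge0 NN _) (Jr' xs xs_in).
have rs_gt0 : 0 < rs by rewrite /rs lt_min r_gt0.
have d0 : 0 < delta by rewrite /delta; lra.
have d1 : delta < 1 by rewrite /delta; lra.
have gxs : g xs = xs by rewrite /g /omega omega0 mulmx0 subr0.
have step y : nball N xs rs y -> N (g y - xs) <= (1 - delta) * N (y - xs).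
  rewrite /nball/= /rs lt_min => /andP[yr yr0].
  rewrite gE gxs -(addrA xs) addrAC subrr add0r.
  by apply: gradient_step_contracts => //; [exact: Jr'|exact: Remr].
(* strictness comes from [x 0] being in the open ball and 1 - delta > 0 *)
have geom j : N (x j - xs) < (1 - delta) ^+ j * rs.
  elim: j => [|j IH]; first by rewrite mul1r.
  have xj : nball N xs rs (x j).
    apply: lt_le_trans IH _; rewrite ler_piMl ?(ltW rs_gt0)//.
    by rewrite exprn_ile1//; lra.
  rewrite xS exprS -mulrA; apply: le_lt_trans (step _ xj) _.
  by rewrite ltr_pM2l//; lra.
exact: lt_le_trans (geom k) (geometric_le_of_ceil d0 d1 rs_gt0 eps_gt0 hk).
Qed.
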